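(* Let $\mathcal{F}$ be an $f$-triangle of size $d\in\mathbb{N}\cup\{\infty\}$ and $\Gamma_n$ be an $\mathcal{F}$-uniform triangulation of the simplex $\sigma_n$ for some (finite) $n \le d$. Then, $p_{\mathcal{F},n,k}(x) = h(\Gamma_{n,k},x)$ for every $k \in \{0,1,\dots,n\}$, where $\Gamma_{n,k}$ is the relative simplicial complex obtained from $\Gamma_n$ by removing all faces carried by any $k$ chosen facets of $\sigma_n$.
   Context: Conventions: $\mathbb{N} = \{0,1,2,\dots\}$; $\binom{a}{b}:=0$ unless $0\le b\le a$. All simplicial complexes are finite abstract simplicial complexes (containing the empty face, of dimension $-1$). $\sigma_n$ is the $(n-1)$-dimensional simplex (the complex of all its faces); here ''facets of $\sigma_n$'' means its $n$ faces of dimension $n-2$. A simplicial complex $\Delta'$ is a triangulation of $\Delta$ if there are geometric realizations $K'$ and $K$ of $\Delta'$ and $\Delta$ such that $K'$ geometrically subdivides $K$. For $F \in \Delta$, the restriction $\Delta'_F$ is the subcomplex of $\Delta'$ corresponding to the triangulation which $K'$ induces on the simplex of $K$ corresponding to $F$. An $f$-triangle of size $d$ is a triangular array $\mathcal{F} = (f_{\mathcal{F}}(i,j))_{0 \le i \le j \le d}$ of nonnegative integers. Given a simplicial complex $\Delta$ of dimension less than $d$, a triangulation $\Delta'$ of $\Delta$ is $\mathcal{F}$-uniform if for all $0 \le i \le j \le d$, the restriction of $\Delta'$ to any $(j-1)$-dimensional face of $\Delta$ has exactly $f_{\mathcal{F}}(i,j)$ faces of dimension $i-1$. Put $f_{\mathcal{F}}(\sigma_n,x)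 = \sum_{i=0}^n f_{\mathcal{F}}(i,n)x^i$, $h_{\mathcal{F}}(\sigma_n,x) = (1-x)^n f_{\mathcal{F}}(\sigma_n,\frac{x}{1-x})$, $\ell_{\mathcal{F}}(\sigma_n,x) = \sum_{k=0}^n (-1)^{n-k}\binom{n}{k} h_{\mathcal{F}}(\sigma_k,x)$, and for $0\le k\le n\le d$ $$p_{\mathcal{F},n,k}(x) = \sum_{r=0}^n \ell_{\mathcal{F}}(\sigma_r,x) \sum_{i=0}^r \binom{n-k}{i}\binom{k}{r-i} x^{k-r+i}.$$ $\Gamma_{n,k}$ consists of the faces of $\Gamma_n$ (including possibly the empty face) which do not belong to the restriction of $\Gamma_n$ to any of the $k$ chosen facets of $\sigma_n$ (so $\Gamma_{n,0}=\Gamma_n$). Its $h$-polynomial is $h(\Gamma_{n,k},x)=(1-x)^nf(\Gamma_{n,k},\frac{x}{1-x})$, where $f(\Gamma_{n,k},x)=\sum_{i=0}^n f_{i-1}x^i$ and $f_{i-1}$ is the number of $(i-1)$-dimensional faces in $\Gamma_{n,k}$. *)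

(* Defs.v *)
From HB Require Import structures.
From mathcomp Require Import boolp classical_sets reals.
From mathcomp Require Import all_boot all_order all_algebra.

Set Implicit Arguments.
Unset Strict Implicit.
Unset Printing Implicit Defensive.

Import Order.TTheory GRing.Theory Num.Theory.
Local Open Scope ring_scope.

(* Elements of V that lie in no face are allowed; they are not vertices of the
   complex.  An (i-1)-dimensional face is a face of cardinality i. *)
Record simplicial_complex (V : finType) := SimplicialComplex {
  faces :> {set {set V}};
  faces_set0 : set0 \in faces;
  faces_sub : forall F G : {set V}, F \in faces -> G \subset F -> G \in faces
}.

Definition face_count (V : finType) (E : {set {set V}}) (i : nat) : nat :=
  #|[set F in E | #|F| == i]|.

Lemma sigma_set0 (n : nat) : set0 \in [set: {set 'I_n}].
Proof. by rewrite inE. Qed.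

Lemma sigma_sub (n : nat) (F G : {set 'I_n}) :
  F \in [set: {set 'I_n}] -> G \subset F -> G \in [set: {set 'I_n}].
Proof. by rewrite !inE. Qed.

Definition sigma (n : nat) : simplicial_complex 'I_n :=
  SimplicialComplex (@sigma_set0 n) (@sigma_sub n).

(* The codimension one faces, of dimension n - 2; there are n of them, in
   particular none for n = 0. *)
Definition sigma_facets (n : nat) : {set {set 'I_n}} :=
  [set F : {set 'I_n} | #|F|.+1 == n].

Section Geometry.
Variables (R : realType) (m : nat).

Definition conv (V : finType) (pos : V -> 'rV[R]_m) (F : {set V}) :
    set 'rV[R]_m :=
  [set y | exists c : V -> R,
     [/\ forall v, v \in F -> 0 <= c v,
         \sum_(v in F) c v = 1
       & y = \sum_(v in F) c v *: pos v]]%classic.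

Definition affinely_independent (V : finType) (pos : V -> 'rV[R]_m)
    (F : {set V}) : Prop :=
  forall c : V -> R,
    \sum_(v in F) c v = 0 -> \sum_(v in F) c v *: pos v = 0 ->
    forall v, v \in F -> c v = 0.

(* The geometric simplicial complex {conv pos F | F a face of D}, whose abstract
   complex is identified with D through pos. *)
Definition geometric_realization (V : finType) (D : simplicial_complex V)
    (pos : V -> 'rV[R]_m) : Prop :=
  (forall F, F \in faces D -> affinely_independent pos F) /\
  (forall F G, F \in faces D -> G \in faces D ->
     (conv pos F `&` conv pos G = conv pos (F :&: G))%classic).

Definition polyhedron (V : finType) (D : simplicial_complex V)
    (pos : V -> 'rV[R]_m) : set 'rV[R]_m :=
  [set y | exists2 F, F \in faces D & conv pos F y]%classic.

Definition subdivides (V' V : finType)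
    (D' : simplicial_complex V') (pos' : V' -> 'rV[R]_m)
    (D : simplicial_complex V) (pos : V -> 'rV[R]_m) : Prop :=
  (forall G, G \in faces D' ->
     exists2 F, F \in faces D & (conv pos' G `<=` conv pos F)%classic) /\
  polyhedron D' pos' = polyhedron D pos.

End Geometry.

(* The realizations are part of the data, since restrictions depend on them. *)
Record triangulation (R : realType) (V : finType) (D : simplicial_complex V)
    (V' : finType) := Triangulation {
  tri_complex :> simplicial_complex V';
  tri_dim : nat;
  tri_pos' : V' -> 'rV[R]_tri_dim;
  tri_pos : V -> 'rV[R]_tri_dim;
  tri_realization' : geometric_realization tri_complex tri_pos';
  tri_realization : geometric_realization D tri_pos;
  tri_subdivides : subdivides tri_complex tri_pos' D tri_pos
}.

Definition restriction (R : realType) (V : finType) (D : simplicial_complex V)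
    (V' : finType) (T : triangulation R D V') (F : {set V}) :
    {set {set V'}} :=
  [set G in faces T | `[< (conv (tri_pos' T) G `<=` conv (tri_pos T) F)%classic >]].

(* None stands for the size infinity. *)
Definition le_size (n : nat) (d : option nat) : bool :=
  if d is Some d' then (n <= d')%N else true.

(* An f-triangle of size d is given by a function of which only the values
   F i j with i <= j <= d are relevant. *)
Definition f_triangle := nat -> nat -> nat.

Definition uniform (d : option nat) (F : f_triangle) (R : realType)
    (V : finType) (D : simplicial_complex V) (V' : finType)
    (T : triangulation R D V') : Prop :=
  forall i j : nat, (i <= j)%N -> le_size j d ->
  forall A : {set V}, A \in faces D -> #|A| = j ->
  face_count (restriction T A) i = F i j.

(* (1 - x)^n f(x / (1 - x)) with denominators cleared: see h_transformE. *)
Definition h_transform (n : nat) (f : {poly int}) : {poly int} :=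
  \sum_(i < n.+1) f`_i *: ('X^i * (1 - 'X) ^+ (n - i)).

Lemma h_transformE (n : nat) (f : {poly int}) : (size f <= n.+1)%N ->
  let x : {fraction {poly int}} := tofrac 'X in
  tofrac (h_transform n f) =
  (1 - x) ^+ n * (map_poly (fun a : int => tofrac a%:P) f).[x / (1 - x)].
Proof.
move=> sf /=; set x := tofrac 'X.
have x1 : 1 - x != 0.
  rewrite -tofrac1 -tofracB tofrac_eq0; apply/eqP => /(congr1 (horner^~ 0)).
  by rewrite !hornerE.
rewrite (@horner_coef_wide _ n.+1); last by rewrite (leq_trans (size_poly _ _)).
rewrite /h_transform rmorph_sum mulr_sumr; apply: eq_bigr => i _.
have le_in : (i <= n)%N by rewrite -ltnS.
rewrite coef_map_id0 ?polyC0 ?tofrac0 // -mul_polyC /= !tofracM !tofracXn tofracB tofrac1.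
rewrite -/x [RHS]mulrCA; congr (_ * _).
rewrite expr_div_n [RHS]mulrCA; congr (_ * _).
by rewrite exprB ?unitfE.
Qed.

Definition f_poly (F : f_triangle) (n : nat) : {poly int} :=
  \poly_(i < n.+1) (F i n)%:Z.

Definition h_poly (F : f_triangle) (n : nat) : {poly int} :=
  h_transform n (f_poly F n).

Definition local_h_poly (F : f_triangle) (n : nat) : {poly int} :=
  \sum_(k < n.+1) ((-1) ^+ (n - k) * 'C(n, k)%:R) *: h_poly F k.

(* The exponent k - r + i is written k + i - r because subtraction on nat is
   truncated; r - i <= k whenever the binomial coefficients are nonzero. *)
Definition p_poly (F : f_triangle) (n k : nat) : {poly int} :=
  \sum_(r < n.+1) local_h_poly F r *
    \sum_(i < r.+1) ('C(n - k, i) * 'C(k, r - i))%:R *: 'X^(k + i - r).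

(* S is the set of chosen facets. *)
Definition relative_complex (R : realType) (n : nat) (V' : finType)
    (T : triangulation R (sigma n) V') (S : {set {set 'I_n}}) :
    {set {set V'}} :=
  [set G in faces T | [forall F in S, G \notin restriction T F]].

Definition f_poly_faces (n : nat) (V' : finType) (E : {set {set V'}}) :
    {poly int} :=
  \poly_(i < n.+1) (face_count E i)%:Z.

Definition h_poly_faces (n : nat) (V' : finType) (E : {set {set V'}}) :
    {poly int} :=
  h_transform n (f_poly_faces n E).

(* Main.v *)
Require Import Defs.
From HB Require Import structures.
From mathcomp Require Import boolp classical_sets reals.
From mathcomp Require Import all_boot all_order all_algebra.

(** Let [K] be the set of vertices of the simplex opposite to the chosen facets.
    The intersection of the facets opposite to the vertices of [J] is the face
    [~: J], so inclusion-exclusion over the subsets [J] of [K] writes the face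
    numbers of the relative complex as an alternating sum of the face numbers
    of the restrictions of the triangulation to the faces [~: J].  These are
    given by the f-triangle: for faces of cardinality at most [#|~: J|] this is
    uniformity, and there are no larger ones, by a dimension count
    ([leq_card_conv_sub]).  On the level of h-polynomials
    ([h_poly_faces_relative]),

      h(relative complex) = sum over J of (x - 1)^|J| h_(n - |J|).

    The comparison with [p_poly] is a computation with umbrae.  Let [H] be the
    linear map from polynomials in [z] over Z[x] to Z[x] sending [z^i] to [h_i].
    The formula above says that the h-polynomial of the relative complex is
    [H (z^(n-k) (z + x - 1)^k)], as is seen by multiplying out.  The local
    h-polynomial [l_r] is [H ((z - 1)^r)].  Hence expanding the same polynomial
    in powers of [y = z - 1], where it reads [(1 + y)^(n-k) (x + y)^k], gives
    the sum of the [l_r] times the coefficient of [y^r], and that coefficient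
    is the inner sum in the definition of [p_poly] ([p_poly_umbra]). *)

Set Implicit Arguments.
Unset Strict Implicit.
Unset Printing Implicit Defensive.

Import Order.TTheory GRing.Theory Num.Theory.
Local Open Scope ring_scope.

(** * Products of sums *)

Lemma prodrD_subset (A : comNzRingType) (I : finType) (K : {set I})
    (a b : I -> A) :
  \prod_(v in K) (a v + b v) =
  \sum_(J : {set I} | J \subset K)
    (\prod_(v in J) a v) * \prod_(v in K :\: J) b v.
Proof.
(* Outside K the factor is 0 + 1, so that any J not inside K contributes 0. *)
transitivity (\prod_v ((if v \in K then a v else 0) +
                       (if v \in K then b v else 1))).
  rewrite big_mkcond; apply: eq_bigr => v _.
  by case: ifP => // _; rewrite add0r.
rewrite bigA_distr [RHS]big_mkcond; apply: eq_bigr => J _.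
case: ifPn => [sJK|/subsetPn[v vJ vK]]; last first.
  by rewrite (bigD1 v) //= vJ (negPf vK) mul0r.
rewrite [X in _ = X * _]big_mkcond [X in _ = _ * X]big_mkcond -big_split.
apply: eq_bigr => v _ /=; rewrite in_setD.
case: ifPn => [/(subsetP sJK) -> //|_]; first by rewrite mulr1.
by rewrite mul1r.
Qed.

Lemma coef_exp_polyCDX (A : comNzRingType) (c : A) (m j : nat) :
  ((c%:P + 'X) ^+ m)`_j = c ^+ (m - j) *+ 'C(m, j).
Proof.
rewrite exprDn coef_sum.
under eq_bigr => i _ do rewrite coefMn -rmorphXn coefCM coefXn.
case: (leqP j m) => [le_jm|lt_mj].
  rewrite (bigD1 (Ordinal (le_jm : (j < m.+1)%N))) //= eqxx mulr1 big1 ?addr0 //.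
  move=> i; rewrite -val_eqE eq_sym /= => /negPf ->.
  by rewrite mulr0 mul0rn.
rewrite bin_small // mulr0n big1 // => i _.
by rewrite gtn_eqF ?mulr0 ?mul0rn // (leq_ltn_trans _ lt_mj) // -ltnS.
Qed.

(** * Umbral evaluation *)

Section Umbra.
Variables (A : comNzRingType) (h : nat -> A).

Definition umbra (q : {poly A}) : A := \sum_(i < size q) q`_i * h i.

Lemma umbra_wide (m : nat) (q : {poly A}) : (size q <= m)%N ->
  umbra q = \sum_(i < m) q`_i * h i.
Proof.
move=> le_qm; rewrite /umbra (big_ord_widen _ (fun i => q`_i * h i) le_qm).
rewrite big_mkcond; apply: eq_bigr => i _.
by case: ltnP => // le_qi; rewrite nth_default ?mul0r.
Qed.

Lemma umbra_is_linear : linear_for *%R umbra.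
Proof.
move=> c p q; pose m := maxn (size p) (size q).
have le_p : (size p <= m)%N by rewrite leq_maxl.
have le_q : (size q <= m)%N by rewrite leq_maxr.
have le_pq : (size (c *: p + q)%R <= m)%N.
  rewrite (leq_trans (size_polyD _ _)) // geq_max le_q andbT.
  by rewrite (leq_trans (size_scale_leq _ _)).
rewrite (umbra_wide le_pq) (umbra_wide le_p) (umbra_wide le_q).
rewrite mulr_sumr -big_split; apply: eq_bigr => i _ /=.
by rewrite coefD coefZ mulrDl mulrA.
Qed.

HB.instance Definition _ :=
  GRing.isLinear.Build A {poly A} A *%R umbra umbra_is_linear.

Lemma umbraXn (i : nat) : umbra 'X^i = h i.
Proof.
rewrite (@umbra_wide i.+1) ?size_polyXn // big_ord_recr /= coefXn eqxx mul1r.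
rewrite big1 ?add0r // => j _.
by rewrite coefXn ltn_eqF ?mul0r.
Qed.

End Umbra.

(** The defining alternating sum is the binomial expansion of [(z - 1)^r]. *)
Lemma local_h_poly_umbra (F : f_triangle) (r : nat) :
  local_h_poly F r = umbra (h_poly F) (('X - 1) ^+ r).
Proof.
rewrite addrC exprDn linear_sum; apply: eq_bigr => k _ /=.
rewrite -scaler_nat -!polyC1 -polyCN -rmorphXn /= mul_polyC scalerA linearZ /=.
rewrite umbraXn -mul_polyC; congr (_ * _).
by rewrite rmorphM rmorphXn rmorphN rmorph_nat mulrC.
Qed.

Lemma p_poly_umbra (F : f_triangle) (n k : nat) : (k <= n)%N ->
  p_poly F n k =
  umbra (h_poly F) ('X^(n - k) * (('X - 1)%:P + 'X) ^+ k).
Proof.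
move=> le_kn.
(* The same polynomial in the variable y = z - 1. *)
pose q : {poly {poly int}} := (1%:P + 'X) ^+ (n - k) * ('X%:P + 'X) ^+ k.
have q_comp : q \Po ('X - 1) = 'X^(n - k) * (('X - 1)%:P + 'X) ^+ k.
  rewrite /q comp_polyM !rmorphXn /= !comp_polyD !comp_polyC !comp_polyX.
  by rewrite polyCB polyC1 addrC subrK addrA addrAC.
have size_q : (size q <= n.+1)%N.
  have size1 (c : {poly int}) : (size (c%:P + 'X)%R <= 2)%N.
    by rewrite (leq_trans (size_polyD _ _)) // size_polyX geq_max size_polyC; case: eqP.
  have sizeE (c : {poly int}) m : (size ((c%:P + 'X) ^+ m)%R <= m.+1)%N.
    rewrite (leq_trans (size_poly_exp_leq _ _)) // ltnS.
    by rewrite -[leqRHS]mul1n leq_mul2r -subn1 leq_subLR size1 orbT.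
  rewrite (leq_trans (size_polyMleq _ _)) //.
  have := leq_add (sizeE 1 (n - k)%N) (sizeE 'X k).
  by rewrite addSn addnS subnK //; case: (_ + _)%N.
rewrite -q_comp comp_polyE linear_sum /=.
under eq_bigr do rewrite linearZ /= -local_h_poly_umbra.
rewrite (big_ord_widen _ (fun i => q`_i * local_h_poly F i) size_q) big_mkcond.
apply: eq_bigr => r _; rewrite [RHS](_ : _ = q`_r * local_h_poly F r); last first.
  by case: ltnP => // le_qr; rewrite nth_default ?mul0r.
rewrite mulrC; congr (_ * _); rewrite /q coefM; apply: eq_bigr => i _.
rewrite !coef_exp_polyCDX expr1n subnBA -1?ltnS //.
by rewrite scaler_nat mulrnA mulr_natl -mulrnA mulnC mulrnA.
Qed.

(** * Restrictions of a triangulation *)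

(** The points of [F] are affine combinations of the points of [G]; a linear
    relation between the rows of the matrix of coefficients would be an affine
    relation between the points of [F], because each row has sum 1. *)
Lemma leq_card_conv_sub (R : realType) (m : nat) (V W : finType)
    (p : V -> 'rV[R]_m) (q : W -> 'rV[R]_m) (F : {set V}) (G : {set W}) :
  affinely_independent p F -> (conv p F `<=` conv q G)%classic ->
  (#|F| <= #|G|)%N.
Proof.
move=> indF sFG.
have vertex v : v \in F -> conv p F (p v).
  move=> vF; exists (fun u => (u == v)%:R).
  split=> [u _||]; first by rewrite ler0n.
    rewrite (bigD1 v) //= eqxx big1 ?addr0 // => u /andP[_ /negPf -> //].
  rewrite (bigD1 v) //= eqxx scale1r big1 ?addr0 // => u /andP[_ /negPf ->].
  by rewrite scale0r.
have {vertex} /choice[c cP] : forall v, exists c : W -> R, v \in F ->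
    \sum_(w in G) c w = 1 /\ p v = \sum_(w in G) c w *: q w.
  move=> v; case: (boolP (v \in F)) => [vF|_]; last by exists (fun=> 0).
  by have [c [_ c1 ->]] := sFG _ (vertex v vF); exists c.
pose C := \matrix_(i < #|F|, j < #|G|) c (enum_val i) (enum_val j).
suff : row_free C by move/eqP => <-; apply: rank_leq_col.
apply: inj_row_free => u uC0.
case: (set_0Vmem F) => [F0|[v0 v0F]].
  by apply/rowP => i; have := enum_valP i; rewrite {2}F0 inE.
pose t v := u 0 (enum_rank_in v0F v).
have tC w : w \in G -> \sum_(v in F) t v * c v w = 0.
  move=> wG; have := congr1 (fun M : 'rV_ _ => M 0 (enum_rank_in wG w)) uC0.
  rewrite !mxE; apply: etrans; rewrite [RHS](big_enum_rank v0F).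
  by apply: eq_bigr => v vF; rewrite mxE !enum_rankK_in.
have t0 : forall v, v \in F -> t v = 0.
  apply: indF.
    transitivity (\sum_(v in F) \sum_(w in G) t v * c v w).
      by apply: eq_bigr => v vF; rewrite -mulr_sumr (cP v vF).1 mulr1.
    by rewrite exchange_big big1.
  transitivity (\sum_(v in F) \sum_(w in G) (t v * c v w) *: q w).
    apply: eq_bigr => v vF; rewrite (cP v vF).2 scaler_sumr.
    by apply: eq_bigr => w _; rewrite scalerA.
  rewrite exchange_big big1 //= => w wG.
  by rewrite -scaler_suml tC ?scale0r.
apply/rowP => i; rewrite mxE -(t0 _ (enum_valP i)) /t.
by rewrite enum_valK_in.
Qed.

Section Restriction.
Variables (R : realType) (V V' : finType) (D : simplicial_complex V).
Variable T : triangulation R D V'.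

Lemma restrictionI (A B : {set V}) : A \in faces D -> B \in faces D ->
  restriction T (A :&: B) = restriction T A :&: restriction T B.
Proof.
move=> AD BD; apply/setP => G; rewrite !inE.
rewrite -((tri_realization T).2 A B AD BD).
case: (G \in faces T) => //=; apply/asboolP/andP => [sG|[/asboolP sA /asboolP sB]].
  by split; apply/asboolP => y /sG[].
by move=> y Gy; split; [apply: sA|apply: sB].
Qed.

(** Every face of the triangulation lies in a restriction to some face of the
    complex, which is contained in the restriction to the whole vertex set. *)
Lemma restriction_setT : [set: V] \in faces D -> restriction T setT = faces T.
Proof.
move=> DT; apply/eqP; rewrite eqEsubset; apply/andP; split.
  by apply/subsetP => G; rewrite inE => /andP[].
apply/subsetP => G GT.
have [A AD sGA] := (tri_subdivides T).1 G GT.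
suff : G \in restriction T (A :&: setT).
  by rewrite restrictionI // => /setIP[].
by rewrite setIT inE GT; apply/asboolP.
Qed.

(** Uniformity prescribes only the face numbers up to the dimension of [A]; the
    others vanish, as do the coefficients of [f_poly] beyond its degree. *)
Lemma face_count_restriction (d : option nat) (F : f_triangle) (A : {set V})
    (i : nat) :
  uniform d F T -> A \in faces D -> le_size #|A| d ->
  (face_count (restriction T A) i)%:Z = (f_poly F #|A|)`_i.
Proof.
move=> unifT AD leA; rewrite coef_poly ltnS.
case: leqP => [le_iA|lt_Ai]; first by rewrite (unifT i #|A|).
rewrite /face_count; congr Posz; apply/eqP; rewrite cards_eq0.
apply/eqP/setP => G; rewrite !inE; apply/negP => /andP[/andP[GT /asboolP sGA]].
move=> /eqP cardG; move: lt_Ai; rewrite ltnNge -cardG => /negP; apply.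
exact: leq_card_conv_sub ((tri_realization' T).1 G GT) sGA.
Qed.

End Restriction.

(** * Inclusion-exclusion over the chosen facets *)

(** Homogenizing to a larger degree multiplies by a power of [1 - x]. *)
Lemma h_transform_sub (n j : nat) (f : {poly int}) : (j <= n)%N ->
  (size f <= (n - j).+1)%N ->
  h_transform n f = (1 - 'X) ^+ j * h_transform (n - j) f.
Proof.
move=> /subnK <-; rewrite addnK; move: (n - j)%N => m le_f.
rewrite /h_transform mulr_sumr.
rewrite (big_ord_widen (m + j).+1
  (fun i => (1 - 'X) ^+ j * (f`_i *: ('X^i * (1 - 'X) ^+ (m - i)))));
  last by rewrite ltnS leq_addr.
rewrite [RHS]big_mkcond; apply: eq_bigr => i _ /=.
case: ltnP => [lt_im|le_mi]; last by rewrite nth_default ?scale0r ?(leq_trans le_f).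
by rewrite -scalerAr mulrCA -exprD addnBA // [(j + m)%N]addnC.
Qed.

Section Relative.
Variables (R : realType) (n : nat) (V' : finType).
Variable T : triangulation R (sigma n) V'.

(** The face [~: J] is the intersection of the facets opposite to the vertices
    of [J], and restriction commutes with intersections of faces. *)
Lemma mem_restriction_setC (G : {set V'}) (J : {set 'I_n}) : G \in faces T ->
  (G \in restriction T (~: J)) =
  [forall v in J, G \in restriction T (~: [set v])].
Proof.
move=> GT; rewrite -big_andE.
have -> : ~: J = \bigcap_(v in J) ~: [set v].
  apply/setP => w; apply/idP/bigcapP => [wJ v vJ|wJ].
    by rewrite !inE; apply: contraTneq wJ => ->; rewrite inE negbK.
  by rewrite inE; apply/negP => /wJ; rewrite !inE eqxx.
apply: (big_morph (fun A => G \in restriction T A)) => [A B|].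
  by rewrite restrictionI ?inE.
by rewrite restriction_setT ?inE.
Qed.

Definition opposite_vertices (S : {set {set 'I_n}}) : {set 'I_n} :=
  [set v | ~: [set v] \in S].

Lemma sigma_facets_opposite (S : {set {set 'I_n}}) : S \subset sigma_facets n ->
  S = [set ~: [set v] | v in opposite_vertices S].
Proof.
move=> sS; apply/setP => A; apply/idP/imsetP => [AS|[v]]; last first.
  by rewrite inE => vS ->.
have := subsetP sS A AS; rewrite inE => /eqP cardA.
have /cards1P[v Av] : #|~: A| == 1%N.
  by rewrite -(eqn_add2l #|A|) cardsC card_ord addn1 cardA.
have AE : A = ~: [set v] by rewrite -Av setCK.
by exists v; rewrite // inE -AE.
Qed.

Lemma card_opposite_vertices (S : {set {set 'I_n}}) :
  S \subset sigma_facets n -> #|opposite_vertices S| = #|S|.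
Proof.
move=> sS; rewrite [in RHS](sigma_facets_opposite sS) card_imset // => v w.
by move/setC_inj/set1_inj.
Qed.

(** Multiplying out the product over [v] in [K] of the indicators
    [1 - [G lies on the facet opposite to v]]. *)
Lemma face_count_relative (S : {set {set 'I_n}}) (i : nat) :
  S \subset sigma_facets n ->
  (face_count (relative_complex T S) i)%:Z =
  \sum_(J : {set 'I_n} | J \subset opposite_vertices S)
    (-1) ^+ #|J| * (face_count (restriction T (~: J)) i)%:Z.
Proof.
move=> sS; set K := opposite_vertices S.
have countE (E : {set {set V'}}) : E \subset faces T ->
    (face_count E i)%:Z =
    \sum_(G in faces T | #|G| == i) (G \in E)%:R :> int.
  move=> sE; rewrite /face_count -natz -sumr_const big_mkcond [RHS]big_mkcond.
  apply: eq_bigr => G _; rewrite inE.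
  case: (boolP (G \in E)) => [/(subsetP sE) -> //|_].
  by rewrite if_same.
rewrite countE; last by apply/subsetP => G; rewrite inE => /andP[].
under [RHS]eq_bigr => J _.
  rewrite countE ?mulr_sumr; last by apply/subsetP => G; rewrite inE => /andP[].
  over.
rewrite exchange_big; apply: eq_bigr => G /andP[GT _] /=.
transitivity (\prod_(v in K) (- (G \in restriction T (~: [set v]))%:R + 1 : int)).
  rewrite inE GT [in LHS](sigma_facets_opposite sS) -/K.
  case: forall_inP => [avoid|meet].
    rewrite big1 // => v vK.
    by rewrite (negPf (avoid _ (imset_f _ vK))) oppr0 add0r.
  suff /exists_inP[v vK Gv] : [exists v in K, G \in restriction T (~: [set v])].
    by rewrite (bigD1 v) //= Gv addNr mul0r.
  apply: contra_notT meet; rewrite negb_exists_in => /forall_inP avoid A.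
  by case/imsetP => v vK ->; apply: avoid.
rewrite prodrD_subset; apply: eq_bigr => J _.
rewrite big1_eq mulr1 prodrN mem_restriction_setC //; congr (_ * _).
case: forall_inP => [on|off]; first by rewrite big1 // => v /on ->.
suff /exists_inP[v vJ /negPf Gv] : [exists v in J, G \notin restriction T (~: [set v])].
  by rewrite (bigD1 v) //= Gv mul0r.
apply: contra_notT off; rewrite negb_exists_in => /forall_inP on v vJ.
by rewrite -[_ \in _]negbK on.
Qed.

(** The restriction to [~: J] enters with the exponent [n] of the whole simplex
    instead of its own [n - #|J|]; the resulting factor [(1 - x)^#|J|] absorbs
    the sign of inclusion-exclusion. *)
Lemma h_poly_faces_relative (d : option nat) (F : f_triangle)
    (S : {set {set 'I_n}}) :
  le_size n d -> uniform d F T -> S \subset sigma_facets n ->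
  h_poly_faces n (relative_complex T S) =
  \sum_(J : {set 'I_n} | J \subset opposite_vertices S)
    ('X - 1) ^+ #|J| * h_poly F (n - #|J|).
Proof.
move=> le_nd unifT sS.
have leJ (J : {set 'I_n}) : (#|J| <= n)%N by rewrite -[leqRHS]card_ord max_card.
have cardC (J : {set 'I_n}) : #|~: J| = (n - #|J|)%N.
  by apply/eqP; rewrite -(eqn_add2l #|J|) cardsC card_ord subnKC.
transitivity (\sum_(J : {set 'I_n} | J \subset opposite_vertices S)
    (-1) ^+ #|J| *: h_transform n (f_poly F (n - #|J|))).
  rewrite /h_transform; under [RHS]eq_bigr do rewrite scaler_sumr.
  rewrite exchange_big; apply: eq_bigr => i _.
  rewrite coef_poly ltn_ord face_count_relative // scaler_suml.
  apply: eq_bigr => J _; rewrite scalerA (face_count_restriction _ unifT) ?inE //.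
    by rewrite cardC.
  rewrite cardC; case: d le_nd {unifT} => //= d.
  exact: leq_trans (leq_subr _ _).
apply: eq_bigr => J _.
rewrite (h_transform_sub (leJ J)) ?size_poly // -mul_polyC mulrA.
by rewrite rmorphXn rmorphN rmorph1 -exprMn mulN1r opprB.
Qed.

End Relative.

Theorem proposition5p8 (R : realType) (d : option nat) (F : f_triangle)
    (n : nat) (hn : le_size n d) (V' : finType)
    (Gamma : triangulation R (sigma n) V') (hGamma : uniform d F Gamma)
    (k : nat) (hk : (k <= n)%N) (S : {set {set 'I_n}})
    (hS : S \subset sigma_facets n) (hSk : #|S| = k) :
  p_poly F n k = h_poly_faces n (relative_complex Gamma S).
Proof.
rewrite p_poly_umbra // (h_poly_faces_relative hn hGamma hS).
have cardK := card_opposite_vertices hS; rewrite hSk in cardK.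
set K := opposite_vertices S in cardK *.
rewrite -cardK -prodr_const prodrD_subset mulr_sumr linear_sum.
apply: eq_bigr => J sJK /=.
rewrite !prodr_const mulrCA -exprD -rmorphXn mul_polyC linearZ /= umbraXn.
congr (_ * h_poly F _).
rewrite cardsDS // addnBA ?subset_leq_card // subnK //.
by rewrite cardK.
Qed.
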